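(* Let $\Sigma$ be an integral $\mathbb Q$-affine polyhedral complex in $\mathbb R^n$, and let $\pi\colon\operatorname{Rat}(\mathbb R^n)\to\operatorname{Rat}(|\Sigma|)$ be the restriction map. Then $\pi$ is surjective, i.e. the restrictions of the coordinate functions $x_1,\dots,x_n$ to $|\Sigma|$ generate the semifield $\operatorname{Rat}(|\Sigma|)$ over $\mathbb T\mathbb Q$. Moreover, the kernel $\operatorname{Ker}(\pi)=\{(F,G)\in\operatorname{Rat}(\mathbb R^n)^2:\pi(F)=\pi(G)\}$ is a finitely generated congruence.
   Context: An integral $\mathbb Q$-affine function on $\mathbb R^n$ is $u\mapsto\langle m,u\rangle+\gamma$ with $m\in\mathbb Z^n$, $\gamma\in\mathbb Q$. An integral $\mathbb Q$-affine polyhedron is a set $\{u: L_i(u)\ge0, i=1,\dots,r\}$ with $L_i$ integral $\mathbb Q$-affine; an integral $\mathbb Q$-affine polyhedral complex is a finite collection of such polyhedra closed under taking faces, any two of which meet in a common face; $|\Sigma|$ is the union. A refinement $\Sigma'$ of $\Sigma$ is such a complex with $|\Sigma'|=|\Sigma|$ and each cell of $\Sigma'$ contained in a cell of $\Sigma$. Two half-lines $\{p+tw\}$, $\{p'+tw'\}$ in $|\Sigma|$ are parallel if $w,w'$ are positive multiples of each other; the slope near infinity of $F$ along $\{p+tw\}$ is $\frac{d}{dt}F(p+tw)$ for $t\gg0$. $\operatorname{Rat}(|\Sigma|)$ is the set consisting of $\infty$ and all functions $F\colon|\Sigma|\to\mathbb R$ which are integral $\mathbb Q$-affine on each cell of some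 integral $\mathbb Q$-affine refinement of $\Sigma$ and have the same slope near infinity along any two parallel half-lines in $|\Sigma|$; it is a semifield with $\oplus=\min$, $\odot=+$. $\mathbb T\mathbb Q=\mathbb Q\cup\{\infty\}$ with $\oplus=\min$, $\odot=+$, embedded as constants. $\operatorname{Rat}(\mathbb R^n)$ is the subsemifield of the semifield of piecewise integral $\mathbb Q$-affine functions on $\mathbb R^n$ (together with $\infty$) generated over $\mathbb T\mathbb Q$ by the coordinate functions $x_1,\dots,x_n$ (i.e. all quotients $p\odot q^{-1}$ of tropical polynomials in $x_1,\dots,x_n$ with coefficients in $\mathbb T\mathbb Q$). A congruence on a semiring $S$ is an equivalence relation $\sim$ such that $a\sim b$, $a'\sim b'$ imply $a+a'\sim b+b'$ and $aa'\sim bb'$. A congruence $\sim$ is finitely generated if there are pairs $F_i\sim G_i$ ($i=1,\dots,r$) such that the smallest congruence containing these pairs equals $\sim$. *)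

(* Defs.v *)
From HB Require Import structures.
From mathcomp Require Import all_boot all_order all_algebra.
From mathcomp Require Import reals.
From Stdlib Require List.
Set Implicit Arguments.
Unset Strict Implicit.
Unset Printing Implicit Defensive.
Import Order.TTheory GRing.Theory Num.Theory.
Local Open Scope ring_scope.

Section TropDefs.
Variable R : realType.
Variable n : nat.

Definition pt := 'I_n -> R.
Definition ray (p w : pt) (t : R) : pt := fun i => p i + t * w i.

Record iaff := IAff { ia_m : 'I_n -> int; ia_g : rat }.
Definition iaff_eval (L : iaff) (u : pt) : R :=
  \sum_(i < n) (ia_m L i)%:~R * u i + ratr (ia_g L).

Definition polyh := seq iaff.
Definition poly_set (P : polyh) (u : pt) : Prop :=
  all (fun L => 0 <= iaff_eval L u) P.

(* F is a face of P: F = P ∩ {L = 0} for an integral Q-affine L >= 0 on P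
   (L = 0 gives P itself, L = 1 gives the empty face) *)
Definition is_face (P : polyh) (F : pt -> Prop) : Prop :=
  exists L : iaff, (forall u, poly_set P u -> 0 <= iaff_eval L u) /\
    (forall u, F u <-> (poly_set P u /\ iaff_eval L u = 0)).

Definition is_complex (S : seq polyh) : Prop :=
  (forall C, List.In C S -> forall F, is_face C F ->
     exists C', List.In C' S /\ forall u, poly_set C' u <-> F u) /\
  (forall C D, List.In C S -> List.In D S ->
     is_face C (fun u => poly_set C u /\ poly_set D u) /\
     is_face D (fun u => poly_set C u /\ poly_set D u)).

Definition support (S : seq polyh) (u : pt) : Prop :=
  exists C, List.In C S /\ poly_set C u.

Definition refines (S' S : seq polyh) : Prop :=
  is_complex S' /\ (forall u, support S' u <-> support S u) /\
  (forall C', List.In C' S' -> exists C, List.In C S /\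
     forall u, poly_set C' u -> poly_set C u).

Definition halfline_in (A : pt -> Prop) (p w : pt) : Prop :=
  forall t : R, 0 <= t -> A (ray p w t).

Definition slope_infty (f : pt -> R) (p w : pt) (s : R) : Prop :=
  exists T : R, forall t, T <= t ->
    f (ray p w t) = f (ray p w T) + (t - T) * s.

(* elements of the semifields: None = infinity, Some f = a real function
   (for Rat(|Sigma|) only its values on |Sigma| matter) *)
Definition tropv := option (pt -> R).

Definition Rat_support (S : seq polyh) (F : tropv) : Prop :=
  match F with
  | None => True
  | Some f =>
    (exists S', refines S' S /\
       forall C, List.In C S' -> exists L : iaff,
         forall u, poly_set C u -> f u = iaff_eval L u) /\
    (forall p p' w : pt, (exists i, w i != 0) ->
       halfline_in (support S) p w -> halfline_in (support S) p' w ->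
       forall s s', slope_infty f p w s -> slope_infty f p' w s' -> s = s')
  end.

(* tropical monomial a ⊙ x^k, a in Q, k in N^n, and tropical polynomials
   (nonempty finite min of monomials; the polynomial infinity is the
   element None) *)
Record tmon := TMon { tm_c : rat; tm_e : 'I_n -> nat }.
Definition tmon_eval (t : tmon) (u : pt) : R :=
  ratr (tm_c t) + \sum_(i < n) (tm_e t i)%:R * u i.
Definition tpoly := (tmon * seq tmon)%type.
Definition tpoly_eval (P : tpoly) (u : pt) : R :=
  foldr (fun t acc => Num.min (tmon_eval t u) acc) (tmon_eval P.1 u) P.2.

Definition Rat_Rn (F : tropv) : Prop :=
  match F with
  | None => True
  | Some f => exists p q : tpoly, forall u, f u = tpoly_eval p u - tpoly_eval q u
  end.

Definition toplus (a b : tropv) : tropv :=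
  match a, b with
  | None, _ => b
  | _, None => a
  | Some f, Some g => Some (fun u => Num.min (f u) (g u))
  end.
Definition totimes (a b : tropv) : tropv :=
  match a, b with
  | Some f, Some g => Some (fun u => f u + g u)
  | _, _ => None
  end.

Definition restr_eq (S : seq polyh) (a b : tropv) : Prop :=
  match a, b with
  | None, None => True
  | Some f, Some g => forall u, support S u -> f u = g u
  | _, _ => False
  end.

Definition is_congr_on (A : tropv -> Prop) (r : tropv -> tropv -> Prop) : Prop :=
  (forall a, A a -> r a a) /\
  (forall a b, A a -> A b -> r a b -> r b a) /\
  (forall a b c, A a -> A b -> A c -> r a b -> r b c -> r a c) /\
  (forall a b a' b', A a -> A b -> A a' -> A b' -> r a b -> r a' b' ->
     r (toplus a a') (toplus b b') /\ r (totimes a a') (totimes b b')).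

Definition gen_congr (A : tropv -> Prop) (k : nat) (F G : 'I_k -> tropv)
  (a b : tropv) : Prop :=
  forall r, is_congr_on A r -> (forall i, r (F i) (G i)) -> r a b.

Definition fin_gen_congr (A : tropv -> Prop) (K : tropv -> tropv -> Prop) : Prop :=
  exists (k : nat) (F G : 'I_k -> tropv),
    (forall i, A (F i) /\ A (G i)) /\
    (forall a b, A a -> A b -> (K a b <-> gen_congr A F G a b)).

End TropDefs.

(* Main.v *)
(** Let [viol_B >= 0] be the largest amount by which an inequality of the cell
    [B] is violated. If an affine function [D] is nonpositive on the
    intersection of two cells [A] and [B], and its slope is nonpositive in
    every common recession direction, then Farkas' lemma in one more dimension
    gives [D <= K viol_B] on [A] for some integer [K].

    Extension: if [f] equals [L] on [A] and [M] on [B], then [M + K viol_B] is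
    [>= f] on [A] and [<= f] on [B], the equality of slopes near infinity
    taking care of the recession directions. Taking the minimum over [B] and
    then the maximum over [A] of these functions yields an element of
    Rat(R^n) restricting to [f].

    Kernel: let [h] be the minimum of [viol_C] over the nonempty cells [C]. A
    function of Rat(R^n) vanishing on the support is Lipschitz, hence has slope
    zero in the recession directions of every cell, and is therefore bounded by
    [K h] in absolute value. So the single pair [(h, 0)] generates the kernel. If
    all cells are empty, [h = 1 + |x_1| + ... + |x_n|] does the same job. *)

Require Import Defs.
From mathcomp Require Import all_boot all_order all_algebra.
From mathcomp Require Import reals boolp functions.
From mathcomp Require Import ring lra.
From Stdlib Require List.

Set Implicit Arguments.
Unset Strict Implicit.
Unset Printing Implicit Defensive.
Import Order.TTheory GRing.Theory Num.Theory.
(* ssralg also has a notation [support]; the one meant here is that of [Defs]. *)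
Import Defs.
Local Open Scope ring_scope.

Lemma In_mapP (T U : Type) (f : T -> U) (s : seq T) (y : U) :
  List.In y [seq f x | x <- s] <-> exists2 x, List.In x s & f x = y.
Proof.
elim: s => [|a s IH] /=; first by split=> // -[].
split=> [[<-|/IH [x xs <-]]|[x [<-|xs] e]]; [by exists a => //; left| |by left|].
  by exists x => //; right.
by right; apply/IH; exists x.
Qed.

(** * Farkas' lemma for finitely many linear forms *)

Section Farkas.
Variables (R : realFieldType) (V : lmodType R).
Implicit Types (s : seq (V -> R)) (a c : V -> R).

(** Membership in the convex cone spanned by [s], with the coefficients split off one at a time so
    that no coefficient vector has to be handled. *)
Fixpoint conic s c : Prop :=
  if s is a :: s' then exists2 l : R, 0 <= l & conic s' (fun x => c x - l * a x)
  else forall x, c x = 0.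

Lemma conic_ext s c c' : c =1 c' -> conic s c -> conic s c'.
Proof.
elim: s c c' => [|a s IH] c c' e /=; first by move=> h x; rewrite -e.
by case=> l l0 h; exists l => //; apply: IH h => x; rewrite e.
Qed.

(** A coefficient [l] of a sheared form contributes [l * b z >= 0] to the coefficient of [a]; these
    contributions add up to [m]. *)
Lemma conic_shear s a c (z : V) :
  (forall b, List.In b s -> 0 <= b z) ->
  conic [seq (fun x => b x + b z * a x) | b <- s] c ->
  exists2 m : R, 0 <= m & conic s (fun x => c x - m * a x).
Proof.
elim: s c => [|b s IH] c pos /=.
  by move=> h; exists 0 => // x; rewrite h mul0r subr0.
case=> l l0 /IH [|m m0 h]; first by move=> d ds; apply: pos; right.
exists (m + l * b z).
  by rewrite addr_ge0// mulr_ge0//; apply: pos; left.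
exists l => //; apply: conic_ext h => x; ring.
Qed.

(* Bartl's proof, by induction on the number of forms: if [z] violates only the
   head form [a], shear along [z] so as to land in the kernel of [a]. *)
Lemma farkas s c :
  (forall a, List.In a s -> scalar a) -> scalar c ->
  (forall x, (forall a, List.In a s -> 0 <= a x) -> 0 <= c x) ->
  conic s c.
Proof.
(* Induction on the length, because the sheared list is not a sublist of [s]. *)
elim: {s}(size s) {-2}s (erefl (size s)) c => [|k IH] [|a s] //= sk c.
  move=> _ lc h x; have := h x (fun _ => False_ind _).
  (* This point is [- x]: without constraints [c] is nonnegative at [x] and at [- x], hence zero. *)
  have := h (- 2 *: x + x) (fun _ => False_ind _); rewrite lc; lra.
case: sk => sk ls lc h.
have la : scalar a by apply: ls; left.
have ls' b : List.In b s -> scalar b by move=> bs; apply: ls; right.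
have [[z [zs cz]]|nz] :=
    pselect (exists z, (forall b, List.In b s -> 0 <= b z) /\ c z < 0); last first.
  exists 0 => //; apply: (@conic_ext _ c); first by move=> x; rewrite mul0r subr0.
  apply: (IH s) => // x xs; rewrite leNgt; apply/negP => cx.
  by apply: nz; exists x.
have az : a z < 0.
  rewrite ltNge; apply/negP => az.
  suff : 0 <= c z by rewrite leNgt cz.
  by apply: h => b [<-|/zs].
have [y [ys ay cy]] :
    exists y, [/\ forall b, List.In b s -> 0 <= b y, a y = -1 & c y < 0].
  have scE (b : V -> R) (l : R) : scalar b -> b (l *: z) = l * b z.
    move=> lb; have := lb l z 0; have := lb 1 0 0.
    by rewrite !addr0 scaler0; lra.
  have k0 : 0 < - (a z)^-1 by rewrite oppr_gt0 invr_lt0.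
  exists (- (a z)^-1 *: z); split.
  - by move=> b bs; rewrite scE ?mulr_ge0 ?zs// ?ltW//; exact: ls'.
  - by rewrite scE// mulNr mulVf// lt_eqF.
  - by rewrite scE// pmulr_rlt0.
have : conic [seq (fun x => b x + b y * a x) | b <- s] (fun x => c x + c y * a x).
  apply: IH; first by rewrite size_map.
  - move=> d /In_mapP [b bs <-] l u v.
    by rewrite (ls' _ bs) la; ring.
  - by move=> l u v; rewrite lc la; ring.
  (* As [a y = -1], the point [a x *: y + x] is the projection of [x] along [y] to the kernel of
     [a]; the sheared forms are the original ones composed with this projection. *)
  - move=> x xs; have -> : c x + c y * a x = c (a x *: y + x) by rewrite lc; ring.
    apply: h => b [<-|bs]; first by rewrite la ay; lra.
    have := xs (fun x => b x + b y * a x); rewrite (ls' _ bs).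
    rewrite addrC mulrC; apply; by apply/In_mapP; exists b.
move/conic_shear => /(_ ys) [m m0 hm].
exists (m - c y); first by lra.
by apply: conic_ext hm => x; ring.
Qed.

(** [K] is the sum of the coefficients. This turns Farkas' lemma into a bound linear in the
    violation. *)
Lemma conic_bound s c : conic s c ->
  exists2 K : R, 0 <= K & forall x b, 0 <= b ->
    (forall a, List.In a s -> - b <= a x) -> - (K * b) <= c x.
Proof.
elim: s c => [|a s IH] c /=.
  by move=> h; exists 0 => // x b _ _; rewrite h mul0r oppr0.
case=> l l0 /IH [K K0 h]; exists (K + l); first by rewrite addr_ge0.
move=> x b b0 hb.
have := h x b b0 (fun d ds => hb d (or_intror ds)).
have := ler_wpM2l l0 (hb a (or_introl erefl)); nra.
Qed.

End Farkas.

(** * Affine functions, recession directions and violations *)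

Section Support.
Variables (R : realType) (n : nat).
Notation pt := (pt R n).
Notation rat_fun f := (@Rat_Rn R n (Some f)).
Implicit Types (L M D : iaff n) (A B C : polyh n) (u v w : pt).

Definition iaff_lin L w : R := \sum_(i < n) (ia_m L i)%:~R * w i.
Definition iaff_sub L M : iaff n :=
  IAff (fun i => ia_m L i - ia_m M i) (ia_g L - ia_g M).
(** Read off from the inequalities, hence the recession cone of the set only if the cell is
    nonempty; empty cells are treated apart below. *)
Definition recession A w : Prop := all (fun L => 0 <= iaff_lin L w) A.

Lemma allPIn (T : Type) (p : pred T) (s : seq T) :
  all p s <-> forall x, List.In x s -> p x.
Proof.
elim: s => [|a s [IH1 IH2]] //=; split.
  by case/andP=> pa /IH1 h x [<-|/h].
by move=> h; rewrite h/=; [apply: IH2 => x xs; apply: h; right | left].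
Qed.

Lemma iaff_lin_sub L M w : iaff_lin (iaff_sub L M) w = iaff_lin L w - iaff_lin M w.
Proof.
rewrite /iaff_lin -sumrB; apply: eq_bigr => i _ /=.
by rewrite rmorphB mulrBl.
Qed.

Lemma iaff_evalE L u : iaff_eval L u = iaff_lin L u + ratr (ia_g L).
Proof. by []. Qed.

Lemma iaff_eval_sub L M u :
  iaff_eval (iaff_sub L M) u = iaff_eval L u - iaff_eval M u.
Proof. by rewrite !iaff_evalE iaff_lin_sub /= rmorphB /=; ring. Qed.

Lemma iaff_lin_comb L (k : R) u v :
  iaff_lin L (fun i => u i + k * v i) = iaff_lin L u + k * iaff_lin L v.
Proof.
rewrite /iaff_lin mulr_sumr -big_split; apply: eq_bigr => i _ /=; ring.
Qed.

Lemma iaff_eval_ray L u w t :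
  iaff_eval L (ray u w t) = iaff_eval L u + t * iaff_lin L w.
Proof. by rewrite !iaff_evalE iaff_lin_comb; ring. Qed.

Lemma poly_set_ray A u w t :
  poly_set A u -> recession A w -> 0 <= t -> poly_set A (ray u w t).
Proof.
move=> /allPIn hu /allPIn hw t0; apply/allPIn => L LA.
by rewrite iaff_eval_ray addr_ge0 ?hu// mulr_ge0 ?hw.
Qed.

Definition violation B u : R :=
  foldr (fun L acc => Num.max (- iaff_eval L u) acc) 0 B.

Lemma violation_ge0 B u : 0 <= violation B u.
Proof. by elim: B => //= L B IH; rewrite le_max IH orbT. Qed.

Lemma violation_in B u : poly_set B u -> violation B u = 0.
Proof.
rewrite /poly_set; elim: B => //= L B IH /andP[L0 /IH ->].
by apply/max_idPr; rewrite oppr_le0.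
Qed.

Lemma le_violation B u L : List.In L B -> - violation B u <= iaff_eval L u.
Proof.
rewrite lerNl; elim: B => //= M B IH [<-|/IH h]; first by rewrite le_max lexx.
by rewrite le_max h orbT.
Qed.

(** * Homogenization of affine functions *)

Let hpt : lmodType R := (('I_n -> R^o) * R^o)%type.

Definition homog L (x : hpt) : R := iaff_lin L x.1 + ratr (ia_g L) * x.2.

Lemma homog_scalar L : scalar (homog L).
Proof.
move=> k u v; rewrite /homog /=.
have -> : (k *: u.1 + v.1) = (fun i => v.1 i + k * u.1 i).
  by apply/funext => i; rewrite addrC.
rewrite iaff_lin_comb.
have -> : (k *: u.2 + v.2) = k * u.2 + v.2 by [].
ring.
Qed.

Lemma homog1 L u : homog L (u, 1) = iaff_eval L u.
Proof. by rewrite /homog /= mulr1. Qed.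

Lemma homog0 L u : homog L (u, 0) = iaff_lin L u.
Proof. by rewrite /homog /= mulr0 addr0. Qed.

Lemma homog_pos L (x : hpt) : 0 < x.2 ->
  homog L x = x.2 * iaff_eval L (fun i => 0 + x.2^-1 * x.1 i).
Proof.
move=> x0; rewrite iaff_evalE iaff_lin_comb /homog.
have -> : iaff_lin L (fun=> 0) = 0 by rewrite /iaff_lin big1// => i _; rewrite mulr0.
by rewrite add0r mulrDr mulrA divff ?gt_eqF// mul1r [_ * ratr _]mulrC.
Qed.

(* The hypotheses say that [D <= 0] on the intersection of the cones over [A]
   and [B] in one more dimension, points at infinity included. *)
Lemma violation_dominates A B D :
  (forall u, poly_set A u -> poly_set B u -> iaff_eval D u <= 0) ->
  (forall w, recession A w -> recession B w -> iaff_lin D w <= 0) ->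
  exists K : nat, forall u, poly_set A u ->
    iaff_eval D u <= K%:R * violation B u.
Proof.
move=> hfin hrec.
(* The height is one of the forms, so only heights [>= 0] are tested: positive ones rescale to
   points of the cells, height 0 gives recession directions. *)
pose s : seq (hpt -> R) := (fun x => x.2) :: map homog (A ++ B).
have inAB L : List.In L A \/ List.In L B -> List.In (homog L) s.
  by move=> h; right; apply/In_mapP; exists L => //; apply/List.in_app_iff.
have sP (P : (hpt -> R) -> Prop) : P (fun x => x.2) ->
    (forall L, List.In L A -> P (homog L)) -> (forall L, List.In L B -> P (homog L)) ->
    forall a, List.In a s -> P a.
  move=> P0 PA PB a [<-//|/In_mapP [L + <-]].
  by move=> /List.in_app_iff [/PA|/PB].
have : conic s (fun x => - homog D x).
  apply: farkas.
  - by apply: sP => // L _; apply: homog_scalar.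
  - by move=> k u v; rewrite homog_scalar; ring.
  move=> x hx; rewrite oppr_ge0.
  have : 0 <= x.2 by apply: (hx (fun x => x.2)); left.
  rewrite le_eqVlt => /orP[/eqP x0|x0].
    have xE : x = (x.1, 0) by rewrite [0]x0 -surjective_pairing.
    rewrite xE homog0; apply: hrec; apply/allPIn => L LA.
      by rewrite -homog0 -xE; apply: hx; apply: inAB; left.
    by rewrite -homog0 -xE; apply: hx; apply: inAB; right.
  rewrite homog_pos// pmulr_rle0//; apply: hfin; apply/allPIn => L LA.
    by rewrite -(pmulr_rge0 _ x0) -homog_pos//; apply: hx; apply: inAB; left.
  by rewrite -(pmulr_rge0 _ x0) -homog_pos//; apply: hx; apply: inAB; right.
move=> /conic_bound [K K0 hK].
(* Rounded up to an integer, since integer multiples stay in Rat(R^n). *)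
exists (Num.bound K) => u uA.
have : - (K * violation B u) <= - homog D (u, 1).
  apply: hK; first exact: violation_ge0.
  apply: sP => [|L LA|L LB] /=.
  - by rewrite (le_trans _ ler01)// oppr_le0 violation_ge0.
  - rewrite homog1 (@le_trans _ _ 0) ?oppr_le0 ?violation_ge0//.
    by move/allPIn: uA; apply.
  - by rewrite homog1; apply: le_violation.
rewrite homog1 lerN2 => /le_trans; apply.
by rewrite ler_wpM2r ?violation_ge0// ltW// archi_boundP.
Qed.

(** * Closure properties of Rat(R^n) *)

Definition tpoly_fun (f : pt -> R) := exists p : tpoly n, forall u, f u = tpoly_eval p u.

Lemma tpoly_eval_cons t (s : seq (tmon n)) (r : tmon n) u :
  tpoly_eval (r, t :: s) u = Num.min (tmon_eval t u) (tpoly_eval (r, s) u).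
Proof. by []. Qed.

Lemma tpoly_fun_ext f g : f =1 g -> tpoly_fun f -> tpoly_fun g.
Proof. by move=> e [p hp]; exists p => u; rewrite -e. Qed.

Lemma tpoly_fun_min f g : tpoly_fun f -> tpoly_fun g ->
  tpoly_fun (fun u => Num.min (f u) (g u)).
Proof.
case=> -[r s] fE [[r' s'] gE].
exists (r', r :: s ++ s') => u; rewrite tpoly_eval_cons fE gE.
elim: s {f fE} => [|t s IH] //=; rewrite !tpoly_eval_cons.
by rewrite -minA IH minCA.
Qed.

Lemma tpoly_fun_add f g : tpoly_fun f -> tpoly_fun g ->
  tpoly_fun (fun u => f u + g u).
Proof.
(* Addition distributes over the minimum, which reduces two polynomials to a monomial and a
   polynomial, and then to two monomials. *)
have mm (t t' : tmon n) : tpoly_fun (fun u => tmon_eval t u + tmon_eval t' u).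
  exists (TMon (tm_c t + tm_c t') (fun i => tm_e t i + tm_e t' i)%N, [::]) => u.
  rewrite /tpoly_eval /tmon_eval /= rmorphD /= addrACA -big_split; congr (_ + _).
  by apply: eq_bigr => i _; rewrite natrD mulrDl.
have mp (t : tmon n) h : tpoly_fun h -> tpoly_fun (fun u => tmon_eval t u + h u).
  case=> -[r s] hE; apply: (@tpoly_fun_ext (fun u => tmon_eval t u + tpoly_eval (r, s) u)).
    by move=> u; rewrite hE.
  elim: s {h hE} => [|t' s IH]; first exact: mm.
  apply: tpoly_fun_ext (tpoly_fun_min (mm t t') IH) => u.
  by rewrite tpoly_eval_cons addr_minr.
case=> -[r s] fE hg.
apply: (@tpoly_fun_ext (fun u => tpoly_eval (r, s) u + g u)).
  by move=> u; rewrite fE.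
elim: s {f fE} => [|t s IH]; first exact: mp.
apply: tpoly_fun_ext (tpoly_fun_min (mp t _ hg) IH) => u.
by rewrite tpoly_eval_cons addr_minl.
Qed.

Lemma rat_funP f : rat_fun f <->
  exists p q, [/\ tpoly_fun p, tpoly_fun q & forall u, f u = p u - q u].
Proof.
split=> [[p [q e]]|[p [q [[P hp] [Q hq] e]]]].
  by exists (tpoly_eval p), (tpoly_eval q); split => //; [exists p | exists q].
by exists P, Q => u; rewrite e hp hq.
Qed.

Lemma rat_fun_ext f g : f =1 g -> rat_fun f -> rat_fun g.
Proof. by move=> e [p [q h]]; exists p, q => u; rewrite -e. Qed.

Lemma rat_fun_opp f : rat_fun f -> rat_fun (fun u => - f u).
Proof. by case=> p [q h]; exists q, p => u; rewrite h opprB. Qed.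

Lemma rat_fun_add f g : rat_fun f -> rat_fun g -> rat_fun (fun u => f u + g u).
Proof.
move=> /rat_funP [p [q [hp hq fE]]] /rat_funP [p' [q' [hp' hq' gE]]].
apply/rat_funP; exists (fun u => p u + p' u), (fun u => q u + q' u).
by split; [exact: tpoly_fun_add..|move=> u; rewrite fE gE; ring].
Qed.

(** Common denominator: [min (p - q) (p' - q') = min (p + q') (p' + q) - (q + q')]. *)
Lemma rat_fun_min f g : rat_fun f -> rat_fun g ->
  rat_fun (fun u => Num.min (f u) (g u)).
Proof.
move=> /rat_funP [p [q [hp hq fE]]] /rat_funP [p' [q' [hp' hq' gE]]].
apply/rat_funP; exists (fun u => Num.min (p u + q' u) (p' u + q u)), (fun u => q u + q' u).
split; [by apply: tpoly_fun_min; apply: tpoly_fun_add|exact: tpoly_fun_add|].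
by move=> u; rewrite fE gE addr_minl; congr Num.min; ring.
Qed.

Lemma rat_fun_max f g : rat_fun f -> rat_fun g ->
  rat_fun (fun u => Num.max (f u) (g u)).
Proof.
move=> hf hg.
apply: rat_fun_ext (rat_fun_opp (rat_fun_min (rat_fun_opp hf) (rat_fun_opp hg))) => u.
by rewrite -oppr_max opprK.
Qed.

Lemma rat_fun_iaff L : rat_fun (iaff_eval L).
Proof.
(* Exponents are natural numbers, so positive slopes go to the numerator and negative ones to the
   denominator; [Negz k] stands for [- k.+1]. *)
exists (TMon (ia_g L) (fun i => if ia_m L i is Posz k then k else 0%N), [::]).
exists (TMon 0 (fun i => if ia_m L i is Negz k then k.+1 else 0%N), [::]) => u.
rewrite /tpoly_eval /= /tmon_eval /= rmorph0 add0r -addrA -sumrB /iaff_eval addrC.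
congr (_ + _); apply: eq_bigr => i _; case: (ia_m L i) => k.
  by rewrite mul0r subr0.
by rewrite mul0r sub0r NegzE mulrNz mulNr.
Qed.

Lemma rat_fun_cst (q : rat) : rat_fun (fun=> ratr q).
Proof.
apply: rat_fun_ext (rat_fun_iaff (IAff (fun=> 0) q)) => u.
by rewrite /iaff_eval big1 ?add0r// => i _; rewrite mul0r.
Qed.

Lemma rat_fun0 : rat_fun (fun=> 0).
Proof. by apply: rat_fun_ext (rat_fun_cst 0) => u; rewrite rmorph0. Qed.

Lemma rat_fun_mulnat f (k : nat) : rat_fun f -> rat_fun (fun u => k%:R * f u).
Proof.
move=> hf; elim: k => [|k IH].
  by apply: rat_fun_ext rat_fun0 => u; rewrite mul0r.
by apply: rat_fun_ext (rat_fun_add hf IH) => u; rewrite -[k.+1]add1n natrD mulrDl mul1r.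
Qed.

Lemma rat_fun_violation B : rat_fun (violation B).
Proof.
elim: B => [|L B IH]; first exact: rat_fun0.
exact: rat_fun_max (rat_fun_opp (rat_fun_iaff L)) IH.
Qed.

(** * Growth bounds for functions in Rat(R^n) *)

Lemma uniform_bound (T : Type) (s : seq T) (P : T -> nat -> Prop) :
  (forall x k l, (k <= l)%N -> P x k -> P x l) ->
  (forall x, List.In x s -> exists k, P x k) ->
  exists k, forall x, List.In x s -> P x k.
Proof.
move=> mono; elim: s => [|a s IH] h; first by exists 0%N.
have [k hk] := h a (or_introl erefl).
have [x xs|l hl] := IH; first by apply: h; right.
exists (maxn k l) => x [<-|xs]; first by apply: mono hk; rewrite leq_maxl.
by apply: mono (hl x xs); rewrite leq_maxr.
Qed.

Definition tpoly_mons (p : tpoly n) := p.1 :: p.2.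

Lemma tpoly_le p u t : List.In t (tpoly_mons p) -> tpoly_eval p u <= tmon_eval t u.
Proof.
case: p => r s; rewrite /tpoly_mons /=; elim: s => [|t' s IH] /=; first by case=> // ->.
rewrite tpoly_eval_cons ge_min; case=> [e|[<-|h]]; rewrite ?lexx// IH ?orbT//.
  by left.
by right.
Qed.

Lemma tpoly_attained p u :
  exists2 t, List.In t (tpoly_mons p) & tpoly_eval p u = tmon_eval t u.
Proof.
case: p => r s; rewrite /tpoly_mons /=; elim: s => [|t' s [t IH e]]; first by exists r => //; left.
rewrite tpoly_eval_cons; case: leP => _; first by exists t' => //; right; left.
by exists t => //; case: IH => [->|]; [left|right; right].
Qed.

Definition dist1 u v : R := \sum_(i < n) `|u i - v i|.

Lemma dist1_ge0 u v : 0 <= dist1 u v.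
Proof. by apply: sumr_ge0. Qed.

(** Each monomial is Lipschitz with its degree as constant, and at [u] the minimum is at most the
    monomial attaining it at [v]. *)
Lemma tpoly_lipschitz p : exists k : nat,
  forall u v, tpoly_eval p u <= tpoly_eval p v + k%:R * dist1 u v.
Proof.
have [t k l kl h u v|t _|k hk] := @uniform_bound _ (tpoly_mons p) (fun t k =>
    forall u v, tmon_eval t u <= tmon_eval t v + k%:R * dist1 u v).
- by apply: le_trans (h u v) _; rewrite lerD2l ler_wpM2r ?dist1_ge0 ?ler_nat.
- exists (\sum_i tm_e t i)%N => u v.
  rewrite /tmon_eval -addrA lerD2l /dist1 mulr_sumr -big_split /=; apply: ler_sum => i _.
  have : (tm_e t i)%:R * (u i - v i) <= (\sum_i tm_e t i)%:R * `|u i - v i|.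
    apply: le_trans (ler_wpM2l _ (ler_norm _)) _ => //.
    by rewrite ler_wpM2r// ler_nat (bigD1 i)//= leq_addr.
  by lra.
exists k => u v; have [t tp ->] := tpoly_attained p v.
exact: le_trans (tpoly_le u tp) (hk _ tp u v).
Qed.

Lemma rat_fun_lipschitz f : rat_fun f -> exists k : nat,
  forall u v, f u <= f v + k%:R * dist1 u v.
Proof.
case=> p [q e]; have [k hk] := tpoly_lipschitz p; have [l hl] := tpoly_lipschitz q.
exists (k + l)%N => u v; rewrite !e.
have dC : dist1 v u = dist1 u v by apply: eq_bigr => i _; rewrite distrC.
by have := hk u v; have := hl v u; rewrite dC natrD mulrDl; lra.
Qed.

Definition tmon_iaff (t : tmon n) : iaff n := IAff (fun i => (tm_e t i)%:Z) (tm_c t).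

Lemma tmon_iaffE t u : iaff_eval (tmon_iaff t) u = tmon_eval t u.
Proof. by rewrite /iaff_eval addrC. Qed.

(** The closed domain of linearity of [p] belonging to [t], possibly empty. *)
Definition active_cell (p : tpoly n) t : polyh n :=
  [seq iaff_sub (tmon_iaff t') (tmon_iaff t) | t' <- tpoly_mons p].

Lemma active_cellP p t u : List.In t (tpoly_mons p) ->
  poly_set (active_cell p t) u <-> tpoly_eval p u = tmon_eval t u.
Proof.
move=> tp; split => [/allPIn h|e].
  have [t' t'p e] := tpoly_attained p u; apply: le_anti; rewrite tpoly_le//= e.
  have := h (iaff_sub (tmon_iaff t') (tmon_iaff t)).
  rewrite iaff_eval_sub !tmon_iaffE subr_ge0; apply.
  by apply/In_mapP; exists t'.
apply/allPIn => L /In_mapP [t' t'p <-].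
by rewrite iaff_eval_sub !tmon_iaffE subr_ge0 -e tpoly_le.
Qed.

Lemma linear_bounded_le0 (a b c : R) :
  (forall t, 0 <= t -> a + t * b <= c) -> b <= 0.
Proof.
move=> h; rewrite leNgt; apply/negP => b0.
have t0 : 0 <= (`|c - a| + 1) / b by rewrite divr_ge0 ?addr_ge0// ltW.
have := h _ t0; rewrite divfK ?gt_eqF//.
by have := ler_norm (c - a); lra.
Qed.

(** On each of the finitely many intersections of a domain of linearity of [p] with one of [q], [f]
    is affine, and [violation_dominates] compares it with [C]. *)
Lemma rat_fun_le_violation C f : (exists u, poly_set C u) ->
  rat_fun f -> (forall u, poly_set C u -> f u = 0) ->
  exists K : nat, forall u, f u <= K%:R * violation C u.
Proof.
move=> [v vC] ratf f0; have [k lip] := rat_fun_lipschitz ratf.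
case: ratf => p [q fE].
have mono (P : pt -> Prop) (K K' : nat) : (K <= K')%N ->
    (forall u, P u -> f u <= K%:R * violation C u) ->
    forall u, P u -> f u <= K'%:R * violation C u.
  move=> KK' h u Pu; apply: le_trans (h u Pu) _.
  by rewrite ler_wpM2r ?violation_ge0 ?ler_nat.
have [t K K' KK' h t' t'q|t tp|K hK] := @uniform_bound _ (tpoly_mons p) (fun t K =>
    forall t', List.In t' (tpoly_mons q) ->
    forall u, tpoly_eval p u = tmon_eval t u /\ tpoly_eval q u = tmon_eval t' u ->
      f u <= K%:R * violation C u).
- exact: mono KK' (h t' t'q).
- apply: uniform_bound; first by move=> t' K K'; exact: mono.
  move=> t' t'q; pose A := active_cell p t ++ active_cell q t'.
  pose D := iaff_sub (tmon_iaff t) (tmon_iaff t').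
  have AP u : poly_set A u <->
      tpoly_eval p u = tmon_eval t u /\ tpoly_eval q u = tmon_eval t' u.
    rewrite /A /poly_set all_cat; split.
      by move=> /andP[] /(active_cellP _ tp) ? /(active_cellP _ t'q) ?.
    by move=> [? ?]; apply/andP; split;
      [apply/(active_cellP _ tp)|apply/(active_cellP _ t'q)].
  have DE u : poly_set A u -> f u = iaff_eval D u.
    by move=> /AP [e e']; rewrite iaff_eval_sub !tmon_iaffE fE e e'.
  have [[u uA]|nA] := pselect (exists u, poly_set A u); last first.
    by exists 0%N => u /AP uA; case: nA; exists u.
  have [x xA xC|w wA wC|K hK] := @violation_dominates A C D.
  + by rewrite -DE// f0.
  (* The rays from [u] and [v] in direction [w] keep a constant distance and [f] vanishes on the
     second, so [f] is bounded above on the first. *)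
  + apply: (@linear_bounded_le0 (iaff_eval D u) _ (k%:R * dist1 u v)) => s s0.
    rewrite -iaff_eval_ray -DE; last exact: poly_set_ray.
    apply: le_trans (lip _ (ray v w s)) _.
    rewrite f0; last exact: poly_set_ray.
    rewrite add0r le_eqVlt; apply/orP; left; apply/eqP; congr (_ * _).
    by apply: eq_bigr => i _; rewrite /ray opprD addrACA subrr addr0.
  + by exists K => x /AP xA; rewrite DE// hK.
exists K => u; have [t tp e] := tpoly_attained p u; have [t' t'q e'] := tpoly_attained q u.
exact: hK t tp t' t'q u (conj e e').
Qed.

Lemma rat_fun_norm1 : rat_fun (fun u => dist1 u (fun=> 0)).
Proof.
have rat_coord i : rat_fun (fun u => u i).
  apply: rat_fun_ext (rat_fun_iaff (IAff (fun j => (j == i)%:Z) 0)) => u.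
  rewrite /iaff_eval /= rmorph0 addr0 (bigD1 i)//= eqxx mul1r big1 ?addr0// => j /negbTE ->.
  by rewrite mul0r.
have rat_sum (s : seq 'I_n) : rat_fun (fun u => \sum_(i <- s) `|u i - 0|).
  elim: s => [|i s IH].
    by apply: rat_fun_ext rat_fun0 => u; rewrite big_nil.
  apply: rat_fun_ext (rat_fun_add (rat_fun_max (rat_coord i) (rat_fun_opp (rat_coord i))) IH) => u.
  by rewrite big_cons subr0 maxrN.
exact: rat_sum.
Qed.

(** * A function in Rat(R^n) cutting out the support *)

Lemma support_gauge (S : seq (polyh n)) : exists h : pt -> R,
  [/\ rat_fun h, forall u, 0 <= h u, forall u, support S u -> h u = 0 &
      forall f, rat_fun f -> (forall u, support S u -> f u = 0) ->
        exists K : nat, forall u, f u <= K%:R * h u].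
Proof.
have [[v [C0 [C0S vC0]]]|nS] := pselect (exists v, support S v); last first.
  (* With empty support every [f] in Rat(R^n) must be dominated; its Lipschitz bound around the
     origin suffices. *)
  exists (fun u => ratr 1 + dist1 u (fun=> 0)); split.
  - exact: rat_fun_add (rat_fun_cst 1) rat_fun_norm1.
  - by move=> u; rewrite rmorph1 addr_ge0 ?dist1_ge0.
  - by move=> u us; case: nS; exists u.
  move=> f rf _; have [k hk] := rat_fun_lipschitz rf.
  exists (k + Num.bound `|f (fun=> 0%R)|%R)%N => u; apply: le_trans (hk u (fun=> 0)) _.
  have := archi_boundP (normr_ge0 (f (fun=> 0))); have := ler_norm (f (fun=> 0)).
  have d0 := dist1_ge0 u (fun=> 0).
  have := mulr_ge0 (ler0n R (Num.bound `|f (fun=> 0)|)) d0; have := ler0n R k.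
  rewrite rmorph1 natrD; lra.
pose vanish f := forall u, support S u -> f u = 0 :> R.
suff : exists h : pt -> R, [/\ rat_fun h, forall u, 0 <= h u,
    forall C u, List.In C S -> poly_set C u -> h u = 0 &
    forall f, rat_fun f -> vanish f -> exists K : nat, forall u, f u <= K%:R * h u].
  move=> [h [h1 hge0 h2 h3]]; exists h; split=> // u [C [CS uC]]; exact: h2 uC.
have : forall C, List.In C S -> List.In C S by [].
(* The induction shrinks only the list of cells on which [h] must vanish, while [vanish] keeps
   referring to all of [S]. It starts from the nonempty cell [C0], an empty minimum being no real
   function. *)
move: {1 3}S; elim => [|C s IH] sS.
  exists (violation C0); split => //.
  - exact: rat_fun_violation.
  - exact: violation_ge0.
  move=> f rf f0; apply: rat_fun_le_violation => //; first by exists v.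
  by move=> u uC; apply: f0; exists C0.
have [D Ds|h [rh h0 hs hdom]] := IH; first by apply: sS; right.
have [neC|eC] := pselect (exists u, poly_set C u); last first.
  (* An empty cell is skipped: its violation may be bounded, and a minimum with it could spoil the
     domination. *)
  exists h; split=> // D u [<-|Ds] uD; first by case: eC; exists u.
  exact: hs uD.
exists (fun u => Num.min (violation C u) (h u)); split.
- exact: rat_fun_min (rat_fun_violation C) rh.
- by move=> u; rewrite le_min violation_ge0 h0.
- move=> D u [<-|Ds] uD; last by rewrite (hs D)//; apply/min_idPr/violation_ge0.
  by rewrite violation_in//; apply/min_idPl.
move=> f rf f0; have [K hK] := hdom f rf f0.
have [u uC|K' hK'] := rat_fun_le_violation neC rf.
  by apply: f0; exists C; split=> //; apply: sS; left.
exists (maxn K K') => u; rewrite minr_pMr ?ler0n// le_min.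
apply/andP; split.
  apply: le_trans (hK' u) _; rewrite ler_wpM2r ?violation_ge0// ler_nat leq_maxr//.
by apply: le_trans (hK u) _; rewrite ler_wpM2r// ler_nat leq_maxl.
Qed.

(** * Extension from the support to R^n *)

Lemma separate_cells A B L M (f : pt -> R) :
  (forall u, poly_set A u -> f u = iaff_eval L u) ->
  (forall u, poly_set B u -> f u = iaff_eval M u) ->
  (forall (p q w : pt), poly_set A p -> poly_set B q -> recession A w -> recession B w ->
     iaff_lin L w = iaff_lin M w) ->
  exists2 g, rat_fun g & (forall u, poly_set A u -> f u <= g u) /\
    (forall u, poly_set B u -> g u <= f u).
Proof.
move=> fL fM hs.
(* If a cell is empty, the slope hypothesis is void, but so is one of the two inequalities to be
   proved. *)
have [[p pA]|nA] := pselect (exists u, poly_set A u); last first.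
  exists (iaff_eval M); first exact: rat_fun_iaff.
  by split=> u hu; [case: nA; exists u|rewrite fM].
have [[q qB]|nB] := pselect (exists u, poly_set B u); last first.
  exists (iaff_eval L); first exact: rat_fun_iaff.
  by split=> u hu; [rewrite fL|case: nB; exists u].
have [u uA uB|w wA wB|K hK] := @violation_dominates A B (iaff_sub L M).
- by rewrite iaff_eval_sub -fL// -fM// subrr.
- by rewrite iaff_lin_sub (hs p q w)// subrr.
exists (fun u => iaff_eval M u + K%:R * violation B u).
  exact: rat_fun_add (rat_fun_iaff M) (rat_fun_mulnat K (rat_fun_violation B)).
split=> u hu; first by have := hK u hu; rewrite iaff_eval_sub fL//; lra.
by rewrite violation_in// mulr0 addr0 fM.
Qed.

(** Serves twice: with [E] a cell for the minimum over [B], and for [- f] with [E] the support for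
    the maximum over [A]. [g0] is the value for the empty list. *)
Lemma rat_fun_min_family (T : Type) (s : seq T) (E : pt -> Prop) (X : T -> pt -> Prop)
    (f g0 : pt -> R) :
  rat_fun g0 -> (forall u, E u -> f u <= g0 u) ->
  (forall x, List.In x s -> exists2 g, rat_fun g &
     (forall u, E u -> f u <= g u) /\ (forall u, X x u -> g u <= f u)) ->
  exists2 g, rat_fun g & (forall u, E u -> f u <= g u) /\
     (forall x u, List.In x s -> X x u -> g u <= f u).
Proof.
move=> r0 h0; elim: s => [|x s IH] h; first by exists g0.
have [g rg [gE gX]] := h x (or_introl erefl).
have [y ys|g' rg' [gE' gX']] := IH; first by apply: h; right.
exists (fun u => Num.min (g u) (g' u)); first exact: rat_fun_min.
split=> [u uE|y u ys uy]; first by rewrite le_min gE// gE'.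
rewrite ge_min; case: ys => [e|ys]; first by rewrite gX ?e.
by rewrite (gX' y) ?orbT.
Qed.

Lemma interpolate_cells (s : seq (polyh n)) (f : pt -> R) :
  (forall C, List.In C s -> exists L, forall u, poly_set C u -> f u = iaff_eval L u) ->
  (forall A B L M (p q w : pt), List.In A s -> List.In B s ->
     (forall u, poly_set A u -> f u = iaff_eval L u) ->
     (forall u, poly_set B u -> f u = iaff_eval M u) ->
     poly_set A p -> poly_set B q -> recession A w -> recession B w ->
     iaff_lin L w = iaff_lin M w) ->
  exists2 g, rat_fun g & forall u, support s u -> g u = f u.
Proof.
move=> faff fslope.
have [[v [C0 [C0s vC0]]]|ns] := pselect (exists v, support s v); last first.
  by exists (fun=> 0); [exact: rat_fun0|move=> u us; case: ns; exists u].
(* Such a [g] agrees with [f] on [A] and stays below it on the rest of the support. *)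
have lower A : List.In A s -> exists2 g, rat_fun g &
    (forall u, poly_set A u -> f u <= g u) /\ (forall u, support s u -> g u <= f u).
  move=> As; have [L fL] := faff A As.
  have [||B Bs|g rg [g1 g2]] :=
      @rat_fun_min_family _ s (poly_set A) (@poly_set R n) f (iaff_eval L).
  - exact: rat_fun_iaff.
  - by move=> u uA; rewrite fL.
  - have [M fM] := faff B Bs; apply: (separate_cells fL fM) => p q w.
    exact: fslope.
  - by exists g => //; split=> // u [B [Bs uB]]; exact: g2 uB.
have [g0 rg0 [_ g0le]] := lower C0 C0s.
have [||B Bs|g rg [g1 g2]] := @rat_fun_min_family _ s (support s) (@poly_set R n)
    (fun u => - f u) (fun u => - g0 u).
- exact: rat_fun_opp.
- by move=> u us; rewrite lerN2 g0le.
- have [g rg [g1 g2]] := lower B Bs; exists (fun u => - g u); first exact: rat_fun_opp.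
  by split=> u hu; rewrite lerN2; [exact: g2|exact: g1].
exists (fun u => - g u); first exact: rat_fun_opp.
move=> u us; have := g1 u us; case: us => [B [Bs uB]]; have := g2 B u Bs uB; lra.
Qed.

Lemma Rat_support_extends (S : seq (polyh n)) (f : pt -> R) :
  Rat_support S (Some f) ->
  exists2 g, rat_fun g & forall u, support S u -> g u = f u.
Proof.
move=> [[S' [[_ [suppE _]] faff]] fslope].
have [|g rg gE] := @interpolate_cells S' f faff; last first.
- by exists g => // u uS; apply: gE; apply/suppE.
move=> A B L M p q w As Bs fL fM pA qB wA wB.
(* Slopes near infinity are compared only for [w] nonzero; for [w = 0] both linear parts vanish. *)
have [wn|w0] := pselect (exists i, w i != 0); last first.
  have w0' i : w i = 0 by apply/eqP; apply: contrapT => /negP wi; apply: w0; exists i.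
  by rewrite /iaff_lin !big1// => i _; rewrite w0' mulr0.
have ray_slope C N x : List.In C S' -> (forall u, poly_set C u -> f u = iaff_eval N u) ->
    poly_set C x -> recession C w ->
    halfline_in (support S) x w /\ slope_infty f x w (iaff_lin N w).
  move=> Cs fN xC wC; split=> [t t0|].
    by apply/suppE; exists C; split=> //; exact: poly_set_ray.
  exists 0 => t t0; rewrite !fN ?iaff_eval_ray; first by ring.
    exact: poly_set_ray.
  exact: poly_set_ray.
have [hp sp] := ray_slope A L p As fL pA wA.
have [hq sq] := ray_slope B M q Bs fM qB wB.
exact: fslope wn hp hq _ _ sp sq.
Qed.

(** * The kernel as a finitely generated congruence *)

Lemma restr_eq_congr (S : seq (polyh n)) : is_congr_on (@Rat_Rn R n) (@restr_eq R n S).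
Proof.
split; [|split; [|split]].
- by case.
- by move=> [f|] [g|] //= _ _ h u us; rewrite h.
- by move=> [f|] [g|] [k|] //= _ _ _ h h' u us; rewrite h// h'.
- move=> [f|] [g|] [f'|] [g'|] //= _ _ _ _ h h'; split=> // u us.
    by rewrite h// h'.
  by rewrite h// h'.
Qed.

(* If [h ~ 0] then [K h ~ 0 ~ - K h], and everything in between is squeezed. *)
Lemma congr_squeeze (r : tropv R n -> tropv R n -> Prop) (h f g : pt -> R) (K : nat) :
  is_congr_on (@Rat_Rn R n) r -> rat_fun h -> rat_fun f -> rat_fun g ->
  r (Some h) (Some (fun=> 0)) ->
  (forall u, `|f u - g u| <= K%:R * h u) -> r (Some f) (Some g).
Proof.
move=> [rr [rs [rt rc]]] Hh Hf Hg rh hb.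
have H0 := rat_fun0.
have HK := rat_fun_mulnat K Hh.
have HNK := rat_fun_opp HK.
have Hd := rat_fun_add Hf (rat_fun_opp Hg).
have someE (x y : pt -> R) : x =1 y -> Some x = Some y by move=> /funext ->.
have rK : r (Some (fun u => K%:R * h u)) (Some (fun=> 0)).
  elim: {HK HNK hb} K => [|k IH].
    by rewrite (someE _ (fun=> 0)) => [|u]; [exact: rr|rewrite mul0r].
  have [_] := rc _ _ _ _ Hh H0 (rat_fun_mulnat k Hh) H0 rh IH => /=.
  rewrite (someE _ (fun u => k.+1%:R * h u)) => [|u].
    by rewrite (someE (fun=> 0 + 0) (fun=> 0)) => [//|u]; rewrite addr0.
  by rewrite -[k.+1]add1n natrD mulrDl mul1r.
(* Both sides of [rK] are multiplied tropically by the inverse of [K h]. *)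
have rNK : r (Some (fun=> 0)) (Some (fun u => - (K%:R * h u))).
  have [_] := rc _ _ _ _ HK H0 HNK HNK rK (rr _ HNK) => /=.
  rewrite (someE _ (fun=> 0)) => [|u]; last by rewrite subrr.
  by rewrite (someE (fun u => 0 + _) (fun u => - (K%:R * h u))) => // u; rewrite add0r.
pose d u := f u - g u.
(* The minimum of [d] with both sides of [rK], where [d <= K h]; next the same with [rNK], where
   [- K h <= d]. *)
have r1 : r (Some d) (Some (fun u => Num.min (d u) 0)).
  have [+ _] := rc _ _ _ _ Hd Hd HK H0 (rr _ Hd) rK => /=.
  rewrite (someE (fun u => Num.min _ (K%:R * h u)) d) => // u.
  by apply/min_idPl; apply: le_trans (ler_norm _) (hb u).
have r2 : r (Some (fun u => Num.min (d u) 0)) (Some (fun u => - (K%:R * h u))).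
  have [+ _] := rc _ _ _ _ Hd Hd H0 HNK (rr _ Hd) rNK => /=.
  rewrite (someE (fun u => Num.min _ (- (K%:R * h u))) (fun u => - (K%:R * h u))) => // u.
  by apply/min_idPr; rewrite lerNl; apply: le_trans (hb u); rewrite -normrN ler_norm.
have Hm := rat_fun_min Hd H0.
have rd0 : r (Some d) (Some (fun=> 0)).
  apply: rt Hd HNK H0 (rt _ _ _ Hd Hm HNK r1 r2) (rs _ _ H0 HNK rNK).
have [_] := rc _ _ _ _ Hd H0 Hg Hg rd0 (rr _ Hg) => /=.
rewrite (someE _ f) => [|u]; last by rewrite subrK.
by rewrite (someE (fun u => 0 + _) g) => // u; rewrite add0r.
Qed.

(** The kernel is a congruence containing [(h, 0)]. Conversely, if [f] and [g] agree on the support,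
    [f - g] and [g - f] are bounded by multiples of [h]; infinity is related only to itself. *)
Lemma restr_eq_fin_gen (S : seq (polyh n)) : fin_gen_congr (@Rat_Rn R n) (@restr_eq R n S).
Proof.
have [h [Hh hge0 h0 hdom]] := support_gauge S.
exists 1%N, (fun=> Some h), (fun=> Some (fun=> 0)); split.
  by move=> _; split=> //; exact: rat_fun0.
move=> a b Ha Hb; split=> [hab r rcong /(_ ord0) rh|]; last first.
  by apply; [exact: restr_eq_congr|move=> _ u; exact: h0].
case: a b Ha Hb hab => [f|] [g|] //= Hf Hg hfg; last by case: rcong => rr _; exact: rr.
have [u us|K hK] := hdom _ (rat_fun_add Hf (rat_fun_opp Hg)).
  by rewrite hfg// subrr.
have [u us|K' hK'] := hdom _ (rat_fun_add Hg (rat_fun_opp Hf)).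
  by rewrite hfg// subrr.
apply: (congr_squeeze (K := maxn K K') rcong Hh Hf Hg rh) => u.
have leK k : (k <= maxn K K')%N -> k%:R * h u <= (maxn K K')%:R * h u.
  by move=> ?; rewrite ler_wpM2r ?ler_nat.
rewrite ler_norml lerNl opprB (le_trans (hK u)) ?(le_trans (hK' u))//.
  by rewrite leK ?leq_maxr.
by rewrite leK ?leq_maxl.
Qed.

End Support.

Theorem theorem1p4 (R : realType) (n : nat) (S : seq (polyh n)) :
  @is_complex R n S ->
  (forall F : tropv R n, @Rat_support R n S F ->
     exists G : tropv R n, @Rat_Rn R n G /\ @restr_eq R n S G F) /\
  @fin_gen_congr R n (@Rat_Rn R n) (@restr_eq R n S).
Proof.
move=> _; split; last exact: restr_eq_fin_gen.
move=> [f|] hf; last by exists None.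
by have [g rg gE] := Rat_support_extends hf; exists (Some g).
Qed.
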